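(* Let $\ell$ be a prime number, let $X$ be a connected finite multigraph and let $\mathfrak{T}\subseteq E_X$ be a fixed spanning tree of $X$. Let $\pi:E_X^+\to E_X$ be the natural quotient map from directed to undirected edges, let $S=\gamma(E_X)$ be the image of a section $\gamma:E_X\to E_X^+$ of $\pi$, and let $S(\mathfrak{T})=\{s\in S:\pi(s)\in\mathfrak{T}\}$. Let $\alpha:S\to\mathbb{Z}_\ell$ be a function satisfying $\alpha(s)=0$ for all $s\in S(\mathfrak{T})$. Then the derived multigraph $X(\mathbb{Z}/\ell^n\mathbb{Z},S,\alpha_{/n})$ is connected for all positive integers $n$ if and only if there exists $s\in S\smallsetminus S(\mathfrak{T})$ such that $\alpha(s)\in\mathbb{Z}_\ell^\times$.
   Context: A finite multigraph $X$ consists of a finite set of vertices $V_X$, a finite set of directed edges $E_X^+$, an incidence function $i:E_X^+\to V_X\times V_X$, $i(e)=(o(e),t(e))$ (origin and target), and an inversion function $\iota:E_X^+\to E_X^+$, $\iota(e)=\bar e$, such that $\iota^2=\mathrm{id}$, $\iota(e)\ne e$ and $i(\bar e)=(t(e),o(e))$ for all $e$. Loops and multiple edges are allowed. The set of undirected edges is $E_X=E_X^+/\iota$, and $\pi:E_X^+\to E_X$ is the $2:1$ quotient map. Connectedness and spanning trees have their usual meaning (a spanning tree is identified with its set of undirected edges). Derived multigraph: let $G$ be a finite abelian group (written additively) and $\beta:S\to G$ a function, extended to $E_X^+$ by $\beta(\bar s)=-\beta(s)$ for $s\in S$. The multigraph $X(G,S,\beta)$ has vertex set $V_X\times G$ and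 directed edge set $E_X^+\times G$; the directed edge $(e,\sigma)$ goes from $(o(e),\sigma)$ to $(t(e),\sigma+\beta(e))$, and its inverse is $\overline{(e,\sigma)}=(\bar e,\sigma+\beta(e))$. For $\alpha:S\to\mathbb{Z}_\ell$, $\alpha_{/n}:S\to\mathbb{Z}/\ell^n\mathbb{Z}$ denotes the reduction of $\alpha$ modulo $\ell^n$. *)

(* Defs.v *)
From HB Require Import structures.
From mathcomp Require Import all_boot all_order all_algebra.
From mathcomp Require Import boolp.

Set Implicit Arguments.
Unset Strict Implicit.
Unset Printing Implicit Defensive.

Import GRing.Theory.

Record multigraph := Multigraph {
  vertex : finType;
  dedge : finType;
  incidence : dedge -> vertex * vertex;
  inversion : dedge -> dedge;
  inversionK : involutive inversion;
  inversion_neq : forall e, inversion e != e;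
  incidence_inversion :
    forall e, incidence (inversion e) = ((incidence e).2, (incidence e).1) }.

Arguments incidence {m} e.
Arguments inversion {m} e.

Definition orig (X : multigraph) (e : dedge X) : vertex X := (incidence e).1.
Definition targ (X : multigraph) (e : dedge X) : vertex X := (incidence e).2.

(* E_X = E_X^+ / iota as the type of the iota-orbits {e, bar e}. *)
Definition uedge (X : multigraph) : predArgType :=
  {A : {set dedge X} | [exists e, A == [set e; inversion e]]}.

Lemma uedge_subproof (X : multigraph) (e : dedge X) :
  [exists f, [set e; inversion e] == [set f; inversion f]].
Proof. by apply/existsP; exists e. Qed.

Definition uproj (X : multigraph) (e : dedge X) : uedge X :=
  exist _ [set e; inversion e] (uedge_subproof e).

Lemma uprojP (X : multigraph) (e f : dedge X) :
  reflect (e = f \/ e = inversion f) (uproj e == uproj f).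
Proof.
apply: (iffP eqP) => [/(congr1 val) /= /setP/(_ e)|].
  by rewrite !inE eqxx /= => /esym/orP[]/eqP; [left|right].
case=> -> //; apply: val_inj => /=.
by rewrite inversionK setUC.
Qed.

Lemma uproj_inversion (X : multigraph) (e : dedge X) :
  uproj (inversion e) = uproj e.
Proof. by apply/eqP/uprojP; right. Qed.

Definition adjacent (X : multigraph) : rel (vertex X) :=
  [rel u v | [exists e, incidence e == (u, v)]].

(* The empty multigraph does not count as connected. *)
Definition connected (X : multigraph) : Prop :=
  0 < #|vertex X| /\ forall u v : vertex X, connect (@adjacent X) u v.

(* A circuit is a nonempty closed path without backtracking (also at the
   closing point) that visits distinct vertices.  A loop is a circuit of
   length 1, and two parallel edges give circuits of length 2. *)
Definition circuit (X : multigraph) (c : seq (dedge X)) : bool :=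
  [&& c != [::],
      cycle (fun e f => (targ e == orig f) && (f != inversion e)) c
    & uniq (map (@orig X) c)].

Definition tree (X : multigraph) : Prop :=
  connected X /\ forall c : seq (dedge X), ~~ circuit c.

Section SpanningSubgraph.

Variables (X : multigraph) (T : {set uedge X}).

Let sedge : predArgType := {e : dedge X | uproj e \in T}.

Let sinversion_subproof (e : sedge) : uproj (inversion (val e)) \in T.
Proof. by rewrite uproj_inversion (valP e). Qed.

Let sinversion (e : sedge) : sedge :=
  exist _ (inversion (val e)) (sinversion_subproof e).

Let sinversionK : involutive sinversion.
Proof. by move=> e; apply: val_inj; rewrite /= inversionK. Qed.

Let sinversion_neq e : sinversion e != e.
Proof. by rewrite -val_eqE /= inversion_neq. Qed.

Definition spanning_subgraph : multigraph :=
  @Multigraph (vertex X) sedge (fun e => incidence (val e)) sinversion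
    sinversionK sinversion_neq (fun e => incidence_inversion (val e)).

End SpanningSubgraph.

Definition spanning_tree (X : multigraph) (T : {set uedge X}) : Prop :=
  tree (spanning_subgraph T).

Definition section_image (X : multigraph) (S : {set dedge X}) : Prop :=
  exists2 gamma : uedge X -> dedge X,
    cancel gamma (@uproj X) & S = [set gamma x | x : uedge X].

Lemma section_image_inversion (X : multigraph) (S : {set dedge X}) :
  section_image S -> forall e, (inversion e \in S) = (e \notin S).
Proof.
case=> gamma gammaK -> e.
have inS f : (f \in [set gamma x | x : uedge X]) = (gamma (uproj f) == f).
  apply/imsetP/eqP => [[x _ ->]|<-]; first by rewrite gammaK.
  by exists (uproj f).
rewrite !inS uproj_inversion.
have /eqP/uprojP[->|->] := gammaK (uproj e).
  by rewrite eqxx eq_sym (negPf (inversion_neq e)).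
by rewrite eqxx inversion_neq.
Qed.

(* The extension of beta to E_X^+ by beta(bar s) = - beta(s).  When S is the
   image of a section, the last branch is never reached. *)
Definition voltage (X : multigraph) (G : zmodType) (S : {set dedge X})
    (beta : {s : dedge X | s \in S} -> G) (e : dedge X) : G :=
  if insub e is Some s then beta s
  else if insub (inversion e) is Some s then (- beta s)%R else 0%R.

Section Derived.

Variables (X : multigraph) (G : finZmodType) (S : {set dedge X}).
Hypothesis S_section : section_image S.
Variable beta : {s : dedge X | s \in S} -> G.

Local Open Scope ring_scope.

Lemma voltage_inversion e : voltage beta (inversion e) = - voltage beta e.
Proof.
rewrite /voltage inversionK; have := section_image_inversion S_section e.
case: insubP => [s ieS _|/negPf->]; case: insubP => [s' eS _|/negPf eNS] //.
- by rewrite ieS eS.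
- by rewrite opprK.
- by rewrite eNS.
Qed.

Let dvertex : finType := (vertex X * G)%type.
Let ddedge : finType := (dedge X * G)%type.

Let dincidence (f : ddedge) : dvertex * dvertex :=
  ((orig f.1, f.2), (targ f.1, f.2 + voltage beta f.1)).

Let dinversion (f : ddedge) : ddedge :=
  (inversion f.1, f.2 + voltage beta f.1).

Let dinversionK : involutive dinversion.
Proof.
by case=> e sigma; rewrite /dinversion /= inversionK voltage_inversion addrK.
Qed.

Let dinversion_neq f : dinversion f != f.
Proof. by apply/eqP => /(congr1 fst)/eqP; apply/negP/inversion_neq. Qed.

Let dincidence_inversion f :
  dincidence (dinversion f) = ((dincidence f).2, (dincidence f).1).
Proof.
rewrite /dincidence /= voltage_inversion addrK /orig /targ.
by rewrite incidence_inversion.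
Qed.

Definition derived : multigraph :=
  Multigraph dinversionK dinversion_neq dincidence_inversion.

End Derived.

Arguments derived X G S S_section beta : clear implicits.

Local Open Scope ring_scope.

(* Z_l as the inverse limit of the rings Z/l^(n+1), n >= 0.  The level Z/l^0
   carries no information and is left out, since 'Z_1 is Z/2. *)
Record padic_int (l : nat) := PadicInt {
  padic_coord :> forall n : nat, 'Z_(l ^ n.+1);
  padic_compat : forall n : nat,
    (padic_coord n.+1 : nat)%:R = padic_coord n }.

HB.instance Definition _ (l : nat) := gen_eqMixin (padic_int l).
HB.instance Definition _ (l : nat) := gen_choiceMixin (padic_int l).

Section PadicRing.

Variable l : nat.
Implicit Types x y z : padic_int l.

Lemma padicP x y : (forall n, x n = y n) -> x = y.
Proof.
case: x y => [x hx] [y hy] /= xy.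
have {xy} xy := functional_extensionality_dep xy.
by case: _ / xy in hy *; congr PadicInt; apply: Prop_irrelevance.
Qed.

Let red n (a : 'Z_(l ^ n.+2)) : 'Z_(l ^ n.+1) := (a : nat)%:R.

Let val_red n (a : 'Z_(l ^ n.+2)) :
  red a = (a %% (Zp_trunc (l ^ n.+1)).+2)%N :> nat.
Proof. by rewrite /red Zp_nat. Qed.

Let trunc_dvd n :
  ((Zp_trunc (l ^ n.+1)).+2 %| (Zp_trunc (l ^ n.+2)).+2)%N.
Proof.
case: (ltnP 1 l) => [l1|]; last first.
  by case: l => [|[|]] // _; rewrite ?exp0n ?exp1n.
rewrite !Zp_cast ?dvdn_exp2l //.
- by rewrite -{1}(exp1n n.+2) ltn_exp2r.
- by rewrite -{1}(exp1n n.+1) ltn_exp2r.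
Qed.

Let redD n (a b : 'Z_(l ^ n.+2)) : red (a + b) = red a + red b.
Proof.
apply: ord_inj; rewrite val_red /= modn_dvdm ?trunc_dvd //.
by rewrite -modnDm -!val_red.
Qed.

Let redM n (a b : 'Z_(l ^ n.+2)) : red (a * b) = red a * red b.
Proof.
apply: ord_inj; rewrite val_red /= modn_dvdm ?trunc_dvd //.
by rewrite -modnMm -!val_red.
Qed.

Let red0 n : red (0 : 'Z_(l ^ n.+2)) = 0.
Proof. by []. Qed.

Let red1 n : red (1 : 'Z_(l ^ n.+2)) = 1.
Proof. by []. Qed.

Let redN n (a : 'Z_(l ^ n.+2)) : red (- a) = - red a.
Proof. by apply/eqP; rewrite -addr_eq0 -redD addNr. Qed.

Definition padic_zero : padic_int l :=
  @PadicInt l (fun=> 0) (fun n => red0 n).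
Definition padic_one : padic_int l :=
  @PadicInt l (fun=> 1) (fun n => red1 n).

Let oppx_compat x n : red (- x n.+1) = - x n.
Proof. by rewrite redN /red padic_compat. Qed.
Definition padic_opp x := @PadicInt l (fun n => - x n) (oppx_compat x).

Let addx_compat x y n : red (x n.+1 + y n.+1) = x n + y n.
Proof. by rewrite redD /red !padic_compat. Qed.
Definition padic_add x y := @PadicInt l (fun n => x n + y n) (addx_compat x y).

Let mulx_compat x y n : red (x n.+1 * y n.+1) = x n * y n.
Proof. by rewrite redM /red !padic_compat. Qed.
Definition padic_mul x y := @PadicInt l (fun n => x n * y n) (mulx_compat x y).

Let addxA : associative padic_add.
Proof. by move=> x y z; apply: padicP => n; apply: addrA. Qed.
Let addxC : commutative padic_add.
Proof. by move=> x y; apply: padicP => n; apply: addrC. Qed.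
Let add0x : left_id padic_zero padic_add.
Proof. by move=> x; apply: padicP => n; apply: add0r. Qed.
Let addNx : left_inverse padic_zero padic_opp padic_add.
Proof. by move=> x; apply: padicP => n; apply: addNr. Qed.

HB.instance Definition _ :=
  GRing.isZmodule.Build (padic_int l) addxA addxC add0x addNx.

Let mulxA : associative padic_mul.
Proof. by move=> x y z; apply: padicP => n; apply: mulrA. Qed.
Let mulxC : commutative padic_mul.
Proof. by move=> x y; apply: padicP => n; apply: mulrC. Qed.
Let mul1x : left_id padic_one padic_mul.
Proof. by move=> x; apply: padicP => n; apply: mul1r. Qed.
Let mulxDl : left_distributive padic_mul padic_add.
Proof. by move=> x y z; apply: padicP => n; apply: mulrDl. Qed.
Let one_neq0 : padic_one != 0.
Proof.
apply/eqP => /(congr1 (fun x : padic_int l => x 0%N)) /eqP.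
by rewrite oner_eq0.
Qed.

HB.instance Definition _ := GRing.Zmodule_isComNzRing.Build (padic_int l)
  mulxA mulxC mul1x mulxDl one_neq0.

Definition padic_unit : pred (padic_int l) :=
  fun x => `[< exists y, y * x = 1 >].

Definition padic_inv x : padic_int l :=
  if pselect (exists y, y * x = 1) is left ex then sval (cid ex) else x.

Let mulVx : {in padic_unit, left_inverse 1 padic_inv *%R}.
Proof.
move=> x /asboolP ex; rewrite /padic_inv.
by case: pselect => // ex'; case: cid.
Qed.
Let unitxP x y : y * x = 1 -> x \in padic_unit.
Proof. by move=> yx; apply/asboolP; exists y. Qed.
Let invx_out : {in [predC padic_unit], padic_inv =1 id}.
Proof.
move=> x /asboolP Nex; rewrite /padic_inv.
by case: pselect.
Qed.

HB.instance Definition _ := GRing.ComNzRing_hasMulInverse.Build (padic_int l)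
  mulVx unitxP invx_out.

End PadicRing.

(* Reduction modulo l^n, for n >= 1.  The coordinate of index n.-1 lives in
   'Z_(l ^ n.-1.+1), hence the cast. *)
Definition padic_mod (l n : nat) (x : padic_int l) : 'Z_(l ^ n) :=
  (x n.-1 : nat)%:R.

Lemma padic_modS (l n : nat) (x : padic_int l) : padic_mod n.+1 x = x n.
Proof. exact: natr_Zp. Qed.

(* Main.v *)
(** The tree lifts to a copy of itself in every sheet, so the derived multigraph
    is connected as soon as one edge of voltage generating G joins the sheets;
    a unit of Z_l is a generator of every Z/l^n.  Conversely, if no voltage is
    a unit then all of them vanish modulo l, and already at level n = 1 no edge
    leaves its sheet. *)
Require Import Defs.
From mathcomp Require Import all_boot all_order all_algebra.

Set Implicit Arguments.
Unset Strict Implicit.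
Unset Printing Implicit Defensive.

Import GRing.Theory.

Section PadicUnits.

Local Open Scope ring_scope.

Variable l : nat.
Hypothesis l_prime : prime l.

Lemma expn_prime_gt1 n : (0 < n -> 1 < l ^ n)%N.
Proof. by move=> n0; rewrite -(exp1n n) ltn_exp2r ?prime_gt1. Qed.

Lemma natr_modn_Zp m q k : (1 < m)%N -> (m %| q)%N ->
  (k %% q)%:R = k%:R :> 'Z_m.
Proof.
by move=> m1 mq; apply: val_inj; rewrite /= !val_Zp_nat // modn_dvdm.
Qed.

Lemma natr_val_ZpM m q (a b : 'Z_q) : (1 < m)%N -> (1 < q)%N -> (m %| q)%N ->
  ((a * b)%R : 'Z_q)%:R = (a : nat)%:R * (b : nat)%:R :> 'Z_m.
Proof.
move=> m1 q1 mq; rewrite -natrM -(natr_modn_Zp (a * b)%N m1 mq).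
(* The product in ['Z_q] is reduced modulo [(Zp_trunc q).+2], which is [q] because [1 < q]. *)
by congr (_%:R); congr (_ %% _)%N; apply: Zp_cast.
Qed.

Lemma padic_coord0 (x : padic_int l) n : (x 0%N : nat) = (x n %% l)%N.
Proof.
have x0l : (x 0%N < l)%N.
  by have := ltn_ord (x 0%N); rewrite [X in (_ < X)%N]Zp_cast ?expn_prime_gt1.
elim: n => [|n ->]; first by rewrite modn_small.
rewrite -(padic_compat x n) val_Zp_nat ?expn_prime_gt1 // modn_dvdm //.
by rewrite expnS dvdn_mulr.
Qed.

(** A residue modulo a power of [l] is invertible iff [l] does not divide it, and its residue modulo
    [l] is the coordinate of index 0. *)
Lemma padic_coord_unit (x : padic_int l) n :
  x 0%N != 0 -> x n \is a GRing.unit.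
Proof.
move=> x0; have m1 := @expn_prime_gt1 n.+1 isT.
rewrite -[x n]natr_Zp unitZpE // coprimeXl // prime_coprime //.
by rewrite /dvdn -padic_coord0.
Qed.

Lemma padic_unitP (x : padic_int l) : reflect (x 0%N != 0) (x \is a GRing.unit).
Proof.
apply: (iffP idP) => [xu|x0].
  apply/eqP => x0; have := congr1 (fun y : padic_int l => y 0%N) (mulVr xu).
  rewrite [LHS]/= x0 mulr0 => /esym/eqP.
  by rewrite oner_eq0.
have compat n : ((x n.+1)^-1 : nat)%:R = (x n)^-1 :> 'Z_(l ^ n.+1).
  (* Inverses are unique, so it suffices that the reduction of the inverse of [x n.+1] is an inverse
     of [x n]. *)
  apply: (mulIr (padic_coord_unit n x0)); rewrite mulVr ?padic_coord_unit //.
  rewrite -(padic_compat x n) -natr_val_ZpM ?expn_prime_gt1 ?dvdn_exp2l //.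
  by rewrite mulVr ?padic_coord_unit.
apply/unitrP; exists (PadicInt compat); split; apply: padicP => n.
  exact/mulVr/padic_coord_unit.
exact/mulrV/padic_coord_unit.
Qed.

End PadicUnits.

Section DerivedConnectivity.

Local Open Scope ring_scope.

Variables (X : multigraph) (G : finZmodType) (S : {set dedge X}).
Hypothesis S_section : section_image S.
Variable beta : {s : dedge X | s \in S} -> G.

Let D := derived X G S S_section beta.

Lemma voltage_section (s : {s : dedge X | s \in S}) :
  voltage beta (val s) = beta s.
Proof. by rewrite /voltage valK. Qed.

(** The hypothesis is phrased with undirected edges because the representative in [S] may be [e] or
    its inverse. *)
Lemma voltage_eq0 (e : dedge X) :
  (forall s, uproj (val s) = uproj e -> beta s = 0) -> voltage beta e = 0.
Proof.
rewrite /voltage => b0; case: insubP => [s _ se|_]; first by rewrite b0 ?se.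
case: insubP => [s _ se|//].
by rewrite b0 ?oppr0 // se uproj_inversion.
Qed.

Lemma derived_adjacent (e : dedge X) (g : G) :
  @adjacent D (orig e, g) (targ e, g + voltage beta e).
Proof. by apply/existsP; exists (e, g). Qed.

Lemma derived_connect_sheet (T : {set uedge X}) u v (g : G) :
    (forall s, uproj (val s) \in T -> beta s = 0) ->
    connect (@adjacent (spanning_subgraph T)) u v ->
  connect (@adjacent D) (u, g) (v, g).
Proof.
move=> bT /connectP[p]; elim: p u => [|w p IHp] u /=; first by move=> _ ->.
case/andP=> /existsP[e /eqP euw] wp vp.
apply: connect_trans (IHp w wp vp); apply: connect1.
have := derived_adjacent (val e) g.
rewrite voltage_eq0 ?addr0 => [|s se]; last by rewrite bT // se (valP e).
have {}euw : incidence (val e) = (u, w) := euw.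
by rewrite /orig /targ euw.
Qed.

(** Each crossing of [s] adds [beta s]: reach the origin of [s] inside the current sheet, cross,
    then move to [v] inside the new sheet. The induction keeps [v] general, since its hypothesis is
    applied with the origin of [s] as endpoint. *)
Lemma derived_connect_generator (T : {set uedge X}) s u v (g : G) k :
    (forall s, uproj (val s) \in T -> beta s = 0) ->
    connected (spanning_subgraph T) ->
  connect (@adjacent D) (u, g) (v, g + beta s *+ k).
Proof.
move=> bT [_ cT]; elim: k v => [|k IHk] v.
  by rewrite mulr0n addr0; apply: derived_connect_sheet (cT _ _).
apply: connect_trans (IHk (orig (val s))) _.
apply: connect_trans (connect1 (derived_adjacent _ _)) _.
rewrite voltage_section -addrA -mulrSr.
exact: derived_connect_sheet (cT _ _).
Qed.

Lemma derived_connect_voltage0 (x y : vertex D) :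
  (forall s, beta s = 0) -> connect (@adjacent D) x y -> x.2 = y.2.
Proof.
move=> b0 /connectP[p]; elim: p x => [|z p IHp] x /=; first by move=> _ ->.
case/andP=> /existsP[e /eqP exz] zp yp; rewrite -(IHp z zp yp).
have : incidence e = (x, z) := exz.
by case=> <- <- /=; rewrite voltage_eq0 ?addr0.
Qed.

End DerivedConnectivity.

Theorem theorem2p15 (l : nat) (l_prime : prime l)
    (X : multigraph) (X_connected : connected X)
    (T : {set uedge X}) (T_tree : spanning_tree T)
    (S : {set dedge X}) (S_section : section_image S)
    (alpha : {s : dedge X | s \in S} -> padic_int l)
    (alpha_T : forall s : {s : dedge X | s \in S},
       uproj (val s) \in T -> alpha s = 0%R) :
  (forall n : nat, 0 < n ->
     connected (derived X 'Z_(l ^ n) S S_section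
                  (fun s => padic_mod n (alpha s))))
  <-> exists s : {s : dedge X | s \in S},
        uproj (val s) \notin T /\ (alpha s \is a GRing.unit).
Proof.
split=> [cD|[s [_ su]] n n0].
  have [/existsP[s su]|/existsPn noU] :=
    boolP [exists s : {s : dedge X | s \in S}, alpha s \is a GRing.unit].
    exists s; split=> //; apply/negP => /alpha_T s0.
    by move: su; rewrite s0 unitr0.
  have [_ c1] := cD 1%N isT.
  have [/card_gt0P[u _] _] := X_connected.
  (* With all voltages zero modulo [l], a path between these two sheets would give 0 = 1 in
     ['Z_(l ^ 1)]. *)
  have := derived_connect_voltage0 _ (c1 (u, 0%R) (u, 1%R)).
  suff b0 s : padic_mod 1 (alpha s) = 0%R.
    by move/(_ b0)/esym/eqP; rewrite oner_eq0.
  rewrite padic_modS; apply/eqP.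
  by apply: contraR (noU s) => /(padic_unitP l_prime).
have bT t : uproj (val t) \in T -> padic_mod n (alpha t) = 0%R.
  by move/alpha_T->.
split=> [|[u g] [v h]].
  have [/card_gt0P[u _] _] := X_connected.
  by apply/card_gt0P; exists (u, 0%R).
(* Level [n.+1] is the coordinate of index [n], so [padic_modS] removes the cast in [padic_mod]. *)
case: n n0 bT g h => // n _ bT g h.
have au : alpha s n \is a GRing.unit.
  exact/padic_coord_unit/(padic_unitP l_prime).
(* The number of crossings is the natural representative of the solution [k] of
   [alpha s n * k = h - g]. *)
have := derived_connect_generator S_section s u v g
  ((alpha s n)^-1 * (h - g))%R bT (proj1 T_tree).
by rewrite padic_modS -mulr_natr natr_Zp mulVKr // addrC subrK.
Qed.
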